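(* Let $U,\hat U\in \mathcal G_k\mathcal P_n$ be polynomial subspaces such that $W(\hat U)=g\cdot W(U)$, where $g\in \mathrm{SL}_2\mathbb C$ is a projective transformation. Suppose furthermore that $\mathrm{Stab}\,W(U)$, the subgroup of projective transformations that leave $W(U)$ invariant, is trivial. Then $U\sim\hat U$ if and only if $\hat U=g\cdot U$.
   Context: Work over $\mathbb C$. $\mathcal P_m$ is the vector space of polynomials in $z$ of degree $\le m$. Fix integers $n\ge 0$, $1\le k\le n+1$, and put $\ell=n+1-k$. $\mathcal G_k\mathcal P_n$ is the Grassmannian of $k$-dimensional subspaces of $\mathcal P_n$. For $g=\begin{pmatrix}a&b\\c&d\end{pmatrix}\in\mathrm{SL}_2\mathbb C$ and $p\in\mathcal P_m$, let $g\cdot p\in\mathcal P_m$ be the polynomial $(g\cdot p)(\hat z)=(c\hat z+d)^m\,p\!\left(\frac{a\hat z+b}{c\hat z+d}\right)$; for a subspace $U\subset\mathcal P_m$, $g\cdot U=\{g\cdot p:p\in U\}$. On subspaces this depends only on the class of $g$ in $\mathrm{PSL}_2\mathbb C=\mathrm{SL}_2\mathbb C/\{\pm I\}$ (the group of projective transformations). Write $U\sim\hat U$ (projectively equivalent) if $\hat U=h\cdot U$ for some $h\in\mathrm{SL}_2\mathbb C$. For $p_1,\dots,p_k\in\mathcal P_n$, the Wronskian is $W(p_1,\dots,p_k)=\det(p_i^{(j-1)})_{1\le i,j\le k}$; if the $p_i$ are linearly independent, it is a nonzero element of $\mathcal P_{k\ell}$. For $U\in\mathcal G_k\mathcal P_n$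 with basis $p_1,\dots,p_k$, $W(U)=\mathrm{span}\{W(p_1,\dots,p_k)\}\in\mathcal G_1\mathcal P_{k\ell}$, a one-dimensional subspace independent of the basis. The action on $W(U)$ is the one on subspaces of $\mathcal P_{k\ell}$, and $\mathrm{Stab}\,W(U)=\{h\in\mathrm{PSL}_2\mathbb C: h\cdot W(U)=W(U)\}$. *)

(* Defs.v *)
From HB Require Import structures.
From mathcomp Require Import all_boot all_order all_algebra.
From mathcomp Require Import perm zify.

Set Implicit Arguments.
Unset Strict Implicit.
Unset Printing Implicit Defensive.

Import GRing.Theory.
Local Open Scope ring_scope.
Local Open Scope quotient_scope.

Section SL2.
Variable F : fieldType.

Record SL2 : predArgType := MkSL2 {
  SL2val :> 'M[F]_2;
  _ : \det SL2val == 1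
}.

HB.instance Definition _ := [isSub for SL2val].
HB.instance Definition _ := [Choice of SL2 by <:].

Implicit Types g h : SL2.

Lemma det_SL2 g : \det g = 1. Proof. exact/eqP/(valP g). Qed.

Fact SL2_one_proof : \det (1%:M : 'M[F]_2) == 1.
Proof. by rewrite det1. Qed.
Fact SL2_mul_proof g h : \det (g *m h) == 1.
Proof. by rewrite det_mulmx !det_SL2 mulr1. Qed.
Fact SL2_inv_proof g : \det (invmx g) == 1.
Proof. by rewrite det_inv det_SL2 invr1. Qed.

Definition SL2_one : SL2 := MkSL2 SL2_one_proof.
Definition SL2_mul g h : SL2 := MkSL2 (SL2_mul_proof g h).
Definition SL2_inv g : SL2 := MkSL2 (SL2_inv_proof g).

Lemma SL2_unit g : (g : 'M[F]_2) \in unitmx.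
Proof. by rewrite unitmxE det_SL2 unitr1. Qed.

Fact SL2_mulA : associative SL2_mul.
Proof. by move=> g h k; apply/val_inj; rewrite /= mulmxA. Qed.
Fact SL2_mul1g : left_id SL2_one SL2_mul.
Proof. by move=> g; apply/val_inj; rewrite /= mul1mx. Qed.
Fact SL2_mulg1 : right_id SL2_one SL2_mul.
Proof. by move=> g; apply/val_inj; rewrite /= mulmx1. Qed.
Fact SL2_mulVg : left_inverse SL2_one SL2_inv SL2_mul.
Proof. by move=> g; apply/val_inj; rewrite /= mulVmx ?SL2_unit. Qed.
Fact SL2_mulgV : right_inverse SL2_one SL2_inv SL2_mul.
Proof. by move=> g; apply/val_inj; rewrite /= mulmxV ?SL2_unit. Qed.

HB.instance Definition _ := isGroup.Build SL2
  SL2_mulA SL2_mul1g SL2_mulg1 SL2_mulVg SL2_mulgV.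

(* Equality modulo [{I, - I}]. *)
Definition eq_pm g h : bool :=
  ((g : 'M_2) == (h : 'M_2)) || ((g : 'M_2) == - (h : 'M_2)).

Fact eq_pm_refl : reflexive eq_pm.
Proof. by move=> g; rewrite /eq_pm eqxx. Qed.
Fact eq_pm_sym : symmetric eq_pm.
Proof. by move=> g h; rewrite /eq_pm eq_sym -eqr_oppLR [- _ == _]eq_sym. Qed.
Fact eq_pm_trans : transitive eq_pm.
Proof.
move=> h g k /orP[]/eqP gh /orP[]/eqP hk;
  by rewrite /eq_pm gh hk ?opprK eqxx ?orbT.
Qed.

Canonical eq_pm_equiv := EquivRel eq_pm eq_pm_refl eq_pm_sym eq_pm_trans.

Definition PSL2 := {eq_quot eq_pm}.
HB.instance Definition _ := Choice.on PSL2.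
HB.instance Definition _ := EqQuotient.on PSL2.

Definition PSL2_one : PSL2 := \pi_PSL2 SL2_one.
Definition PSL2_mul : PSL2 -> PSL2 -> PSL2 := lift_op2 PSL2 SL2_mul.
Definition PSL2_inv : PSL2 -> PSL2 := lift_op1 PSL2 SL2_inv.

Fact pi_PSL2_mul : {morph \pi_PSL2 : g h / SL2_mul g h >-> PSL2_mul g h}.
Proof.
unlock PSL2_mul => g h; apply/eqmodP; rewrite /= /eq_pm.
have: \pi_PSL2 (repr (\pi_PSL2 g)) = \pi_PSL2 g by rewrite reprK.
have: \pi_PSL2 (repr (\pi_PSL2 h)) = \pi_PSL2 h by rewrite reprK.
move=> /eqmodP/orP[]/eqP hE /eqmodP/orP[]/eqP gE;
  by rewrite /= gE hE ?mulNmx ?mulmxN ?opprK eqxx ?orbT.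
Qed.

Fact pi_PSL2_inv : {morph \pi_PSL2 : g / SL2_inv g >-> PSL2_inv g}.
Proof.
unlock PSL2_inv => g; apply/eqmodP; rewrite /= /eq_pm.
have: \pi_PSL2 (repr (\pi_PSL2 g)) = \pi_PSL2 g by rewrite reprK.
move=> /eqmodP/orP[]/eqP gE; rewrite /= gE ?eqxx //.
by rewrite -[- SL2val g]scaleN1r invmxZ ?unitmxZ ?SL2_unit ?unitrN1 //
           invrN1 scaleN1r opprK eqxx orbT.
Qed.

Fact PSL2_mulA : associative PSL2_mul.
Proof.
elim/quotW=> g; elim/quotW=> h; elim/quotW=> k.
by rewrite -!pi_PSL2_mul SL2_mulA.
Qed.
Fact PSL2_mul1g : left_id PSL2_one PSL2_mul.
Proof. by elim/quotW=> g; rewrite -pi_PSL2_mul SL2_mul1g. Qed.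
Fact PSL2_mulg1 : right_id PSL2_one PSL2_mul.
Proof. by elim/quotW=> g; rewrite -pi_PSL2_mul SL2_mulg1. Qed.
Fact PSL2_mulVg : left_inverse PSL2_one PSL2_inv PSL2_mul.
Proof. by elim/quotW=> g; rewrite -pi_PSL2_inv -pi_PSL2_mul SL2_mulVg. Qed.
Fact PSL2_mulgV : right_inverse PSL2_one PSL2_inv PSL2_mul.
Proof. by elim/quotW=> g; rewrite -pi_PSL2_inv -pi_PSL2_mul SL2_mulgV. Qed.

HB.instance Definition _ := isGroup.Build PSL2
  PSL2_mulA PSL2_mul1g PSL2_mulg1 PSL2_mulVg PSL2_mulgV.

End SL2.

Section Action.
Variables (F : fieldType) (m : nat).
Implicit Types (g h : SL2 F) (U V : {vspace {poly_m.+1 F}}).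

Definition SL2_act_poly g (p : {poly F}) : {poly F} :=
  \sum_(i < m.+1) p`_i *:
    ((g 0 0 *: 'X + (g 0 1)%:P) ^+ i * (g 1 0 *: 'X + (g 1 1)%:P) ^+ (m - i)).

Fact size_SL2_act_poly g p : SL2_act_poly g p \is a poly_of_size m.+1.
Proof.
have size_lin (a b : F) e : (size ((a *: 'X + b%:P) ^+ e)%R <= e.+1)%N.
  have sl : (size (a *: 'X + b%:P)%R <= 2)%N.
    rewrite (leq_trans (size_polyD _ _)) // geq_max.
    rewrite (leq_trans (size_scale_leq _ _)) ?size_polyX //=.
    by rewrite (leq_trans (size_polyC_leq1 _)).
  apply: leq_trans (size_poly_exp_leq _ _) _; rewrite ltnS.
  by case: (size _) sl => [|[|[|]]] //= _; rewrite ?mul0n ?mul1n.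
apply: rpred_sum => -[i /= im] _; apply: rpredZ.
apply: leq_trans (size_polyMleq _ _) _.
have := size_lin (g 0 0) (g 0 1) i.
have := size_lin (g 1 0) (g 1 1) (m - i)%N.
by lia.
Qed.

(* As usual for substitutions, this is a right action:
   [g . (h . p) = (h * g) . p]. *)
Definition SL2_act g (p : {poly_m.+1 F}) : {poly_m.+1 F} :=
  NPoly (size_SL2_act_poly g p).

(* On the open set where [c * x + d] is invertible, this is the Moebius
   substitution of weight [m] that defines the action. *)
Lemma horner_SL2_act g (p : {poly_m.+1 F}) x : g 1 0 * x + g 1 1 != 0 ->
  (SL2_act g p : {poly F}).[x] =
  (g 1 0 * x + g 1 1) ^+ m *
    (p : {poly F}).[(g 0 0 * x + g 0 1) / (g 1 0 * x + g 1 1)].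
Proof.
move=> nz; rewrite /= (horner_coef_wide _ (size_npoly p)) mulr_sumr.
rewrite /SL2_act_poly horner_sum; apply: eq_bigr => -[i /= im] _.
rewrite hornerZ hornerM !horner_exp !hornerD !hornerZ !hornerX !hornerC.
rewrite exprMn exprVn [RHS]mulrCA; congr (_ * _); rewrite [RHS]mulrCA; congr (_ * _).
by rewrite -[in RHS](subnK (_ : i <= m)%N) // exprD mulfK // expf_neq0.
Qed.

Fact SL2_act_is_linear g : linear (SL2_act g).
Proof.
move=> a p q; apply/val_inj; rewrite /= /SL2_act_poly scaler_sumr -big_split.
by apply: eq_bigr => i _; rewrite /= coefD coefZ scalerDl scalerA.
Qed.
HB.instance Definition _ g := GRing.isLinear.Build F _ _ _ (SL2_act g)
  (SL2_act_is_linear g).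

Definition SL2_act_vs g U : {vspace {poly_m.+1 F}} :=
  (linfun (SL2_act g) @: U)%VS.

Lemma SL2_act_vs_pm g h U : eq_pm g h -> SL2_act_vs g U = SL2_act_vs h U.
Proof.
have sub g1 g2 : eq_pm g1 g2 -> (SL2_act_vs g1 U <= SL2_act_vs g2 U)%VS.
  move=> /orP[]/eqP eg; first by rewrite (val_inj eg).
  apply/subvP => _ /memv_imgP[p pU ->]; apply/memv_imgP.
  exists ((-1) ^+ m *: p); first exact: memvZ.
  rewrite !lfunE /= linearZ; apply/val_inj => /=; rewrite /SL2_act_poly.
  rewrite scaler_sumr; apply: eq_bigr => -[i /= im] _.
  rewrite [RHS]scalerA [_ * p`_i]mulrC -scalerA; congr (_ *: _); rewrite eg !mxE.
  have opp (a b : F) : - a *: 'X + (- b)%:P = - (a *: 'X + b%:P) :> {poly F}.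
    by rewrite scaleNr polyCN opprD.
  rewrite !opp !(exprNn (_ + _)) mulrACA -exprD subnKC //.
  by rewrite -[in RHS]mul_polyC rmorphXn /= polyCN polyC1.
move=> gh; apply/eqP; rewrite eqEsubv sub //=.
by rewrite sub // [eq_pm _ _](eq_pm_sym _).
Qed.

(* The choice of representative is harmless: see [PSL2_act_vs_pi]. *)
Definition PSL2_act_vs (h : PSL2 F) U := SL2_act_vs (repr h) U.

Lemma PSL2_act_vs_pi g U : PSL2_act_vs (\pi g) U = SL2_act_vs g U.
Proof.
have: \pi_(PSL2 F) (repr (\pi_(PSL2 F) g)) = \pi_(PSL2 F) g by rewrite reprK.
by move=> /eqmodP; apply: SL2_act_vs_pm.
Qed.

Definition Stab U : {pred PSL2 F} := [pred h | PSL2_act_vs h U == U].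

Definition proj_equiv U V : Prop := exists h : SL2 F, V = SL2_act_vs h U.

End Action.

Section Wronskian.
Variables (F : fieldType) (n k : nat).

(* Row [i] lists the derivatives of orders [0, ..., k - 1] of the [i]-th
   polynomial. *)
Definition wronskian_poly (p : k.-tuple {poly_n.+1 F}) : {poly F} :=
  \det (\matrix_(i < k, j < k) (tnth p i : {poly F})^`(j)).

Lemma leq_sum_sorted (s : seq nat) : sorted ltn s ->
  (\sum_(i < size s) i <= \sum_(x <- s) x)%N.
Proof.
move=> ss; rewrite (big_nth 0%N) big_mkord; apply: leq_sum => -[i /= im] _.
elim: i im => [//|i IHi] im; apply: leq_ltn_trans (IHi (ltnW im)) _.
exact: (sortedP 0%N ss).
Qed.

Lemma leq_sum_uniq (s : seq nat) : uniq s ->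
  (\sum_(i < size s) i <= \sum_(x <- s) x)%N.
Proof.
move=> us; rewrite -(size_sort leq) -(perm_big _ (permEl (perm_sort leq s))) /=.
by apply: leq_sum_sorted; rewrite ltn_sorted_uniq_leq sort_uniq us sort_sorted.
Qed.

Lemma sum_inj_ord (f : 'I_k -> 'I_n.+1) : injective f ->
  (\sum_(i < k) f i <= k * (n.+1 - k) + \sum_(i < k) i)%N.
Proof.
move=> f_inj; have kn : (k <= n.+1)%N.
  by have := leq_card _ f_inj; rewrite !card_ord.
have := @leq_sum_uniq [seq val (rev_ord (f i)) | i <- enum 'I_k].
rewrite size_map size_enum_ord big_map big_enum /=.
have u : uniq [seq val (rev_ord (f i)) | i <- enum 'I_k].
  rewrite map_inj_uniq ?enum_uniq // => i j /val_inj /rev_ord_inj; exact: f_inj.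
move=> /(_ u) le.
have eq : (\sum_(i < k) f i + \sum_(i < k) (n.+1 - (f i).+1) = k * n)%N.
  rewrite -big_split /= (eq_bigr (fun=> n)) ?sum_nat_const ?card_ord //.
  by move=> i _; have := ltn_ord (f i); lia.
have tri j : (2 * \sum_(i < j) i = j * j.-1)%N.
  elim: j => [|j IHj]; first by rewrite big_ord0.
  rewrite big_ord_recr /= mulnDr IHj.
  case: j {IHj} => [|j] //=; nia.
move: (tri k) le eq => /=; rewrite (eq_bigl xpredT) //.
move: (\sum_(i < k) i)%N (\sum_(i < k) f i)%N.
move: (\sum_(i < k) (n.+1 - (f i).+1))%N => a b c.
by case: (k) kn => [|k'] /=; nia.
Qed.

Fact size_wronskian_poly p :
  wronskian_poly p \is a poly_of_size (k * (n.+1 - k)).+1.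
Proof.
have pE i j : (tnth p i : {poly F})^`(j) =
    \sum_(a < n.+1) ((tnth p i : {poly F})`_a)%:P * ('X^a)^`(j).
  rewrite {1}[tnth p i : {poly F}](npolyX_gen (size_npoly _)) !raddf_sum.
  by apply: eq_bigr => a _; rewrite /= npolyXE derivnZ mul_polyC.
have -> : wronskian_poly p = \sum_(f : {ffun 'I_k -> 'I_n.+1})
    (\prod_i (tnth p i : {poly F})`_(f i)) *:
      \det (\matrix_(i < k, j < k) ('X^(f i))^`(j)).
  rewrite /wronskian_poly /determinant.
  under eq_bigr => s _ do
    under eq_bigr => i _ do rewrite mxE pE.
  under eq_bigr => s _ do rewrite bigA_distr_bigA mulr_sumr.
  rewrite exchange_big; apply: eq_bigr => f _ /=.
  rewrite scaler_sumr; apply: eq_bigr => s _.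
  rewrite big_split /= -rmorph_prod /= mulrCA mul_polyC.
  by congr (_ *: (_ * _)); apply: eq_bigr => i _; rewrite mxE.
apply: rpred_sum => f _; apply: rpredZ.
have [/injectiveP f_inj|/injectivePn[i1 [i2 ne ef]]] := boolP (injectiveb f);
  last first.
  rewrite (determinant_alternate ne) ?rpred0 // => j.
  by rewrite !mxE ef.
apply: rpred_sum => s _.
rewrite rpredMsign.
have [/forallP sf|] := boolP [forall i, s i <= f i]%N; last first.
  rewrite negb_forall => /existsP; case=> i; rewrite -ltnNge => fs; rewrite (bigD1 i) //= mxE derivnXn ffact_small //.
  by rewrite mulr0n mul0r rpred0.
under eq_bigr => i _ do rewrite mxE derivnXn -scaler_nat.
rewrite scaler_prod -expr_sum; apply: rpredZ.
rewrite unfold_in /= size_polyXn ltnS.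
have := sum_inj_ord f_inj.
have -> : (\sum_(i < k) i = \sum_(i < k) s i)%N.
  by rewrite [LHS](reindex_inj (@perm_inj _ s)).
suff -> : (\sum_(i < k) f i =
           \sum_(i < k) (f i - s i) + \sum_(i < k) s i)%N.
  by rewrite leq_add2r.
by rewrite -big_split; apply: eq_bigr => i _ /=; rewrite subnK.
Qed.

Definition wronskian p : {poly_(k * (n.+1 - k)).+1 F} :=
  NPoly (size_wronskian_poly p).

(* Meaningful when [\dim U = k]; by [wronskian_lineE] any basis of [U] gives
   the same line. *)
Definition wronskian_line (U : {vspace {poly_n.+1 F}}) :
    {vspace {poly_(k * (n.+1 - k)).+1 F}} :=
  <[wronskian [tuple (vbasis U)`_i | i < k]]>%VS.

Lemma wronskian_lineE (U : {vspace {poly_n.+1 F}})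
    (p : k.-tuple {poly_n.+1 F}) :
  basis_of U p -> wronskian_line U = <[wronskian p]>%VS.
Proof.
have sub (q r : k.-tuple {poly_n.+1 F}) : basis_of U q -> basis_of U r ->
    (<[wronskian q]> <= <[wronskian r]>)%VS.
  move=> bq br; rewrite -memvE; apply/vlineP.
  exists (\det (\matrix_(i < k, j < k) coord r j (tnth q i))).
  apply/val_inj; rewrite /= /wronskian_poly -mul_polyC -det_map_mx -det_mulmx.
  congr (\det _); apply/matrixP => i j; rewrite !mxE.
  have qi : tnth q i \in U by apply: (basis_mem bq); apply: mem_tnth.
  rewrite [tnth q i in LHS](coord_basis br qi) !raddf_sum.
  apply: eq_bigr => a _; rewrite !mxE /= -tnth_nth derivnZ.
  by rewrite mul_polyC.
move=> bp.
have bU : basis_of U [tuple (vbasis U)`_i | i < k].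
  have sk : size (vbasis U) = k.
    by rewrite size_tuple -(size_basis bp).
  suff -> : [tuple (vbasis U)`_i | i < k] = vbasis U :> seq _.
    exact: vbasisP.
  apply: (@eq_from_nth _ 0) => [|i]; rewrite size_tuple ?sk // => ik.
  by rewrite -[i in LHS]/(val (Ordinal ik)) -tnth_nth tnth_mktuple.
by apply/eqP; rewrite eqEsubv !sub.
Qed.

End Wronskian.

(* Main.v *)
Require Import Defs.
From mathcomp Require Import all_boot all_order all_algebra.
From mathcomp Require Import ring zify.
From mathcomp Require Import reals complex.

(** The Wronskian is covariant: the line [W(h . U)] is [h . W(U)], where [h]
    acts with weight [n] on the left and weight [k * (n + 1 - k)] on the right
    ([wronskian_line_act]). Hence if [Uhat = h . U], then
    [h . W(U) = W(Uhat) = g . W(U)], so that [h * g^-1] stabilizes [W(U)]. When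
    the stabilizer is trivial, [h] is [g] or [- g], and both transform [U] in
    the same way.

    Covariance is checked at a point [x] where [u = c x + d] is nonzero. Up to
    factorials, the Wronskian at [x] is the determinant of the first [k]
    Taylor coefficients at [x]. Expanding [(g . p)(x + t)] in powers of [t]
    gives

      [sum_j p_j (t / u)^j (u + c t)^(n - j)],

    where the [p_j] are the Taylor coefficients of [p] at
    [y = (a x + b) / u] ([homogeneous_taylor], [nderivn_SL2_act]). The [j]-th
    term has order at least [j] in [t], with leading coefficient
    [u^(n - 2 j)]. The Taylor coefficients of [g . p] at [x] thus arise from
    those of [p] at [y] by a triangular matrix, and the determinant is
    multiplied by the product of the [u^(n - 2 j)] for [j < k], that is, by
    [u^(k (n + 1 - k))] ([wronskian_SL2_act]). As all but at most one point
    [x] are allowed, the equality of values is an equality of polynomials. *)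

Set Implicit Arguments.
Unset Strict Implicit.
Unset Printing Implicit Defensive.

Import GRing.Theory Num.Theory.
Local Open Scope ring_scope.

(** * Homogeneous Taylor formula *)

Lemma horner_nderivn_wide (R : comNzRingType) (m j : nat) (p : {poly R})
    (y : R) :
  (size p <= m)%N ->
  p^`N(j).[y] = \sum_(i < m) p`_i * (y ^+ (i - j) *+ 'C(i, j)).
Proof.
move=> sp; rewrite {1}(_ : p = \sum_(i < m) p`_i *: 'X^i); last first.
  rewrite -poly_def; apply/polyP => i; rewrite coef_poly.
  by case: ltnP => // mi; rewrite nth_default // (leq_trans sp).
rewrite raddf_sum horner_sum; apply: eq_bigr => i _.
by rewrite /= nderivnZ nderivnXn hornerZ hornerMn hornerXn.
Qed.

(** The homogenization of [p] in degree [m], evaluated at the pair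
    [(y v + s, v)], is [v ^ m] times the value of [p] at [y + s / v]; this is
    its Taylor expansion at [y], with denominators cleared so that it holds in
    an algebra where [v] need not be invertible. *)
Lemma homogeneous_taylor (K : comNzRingType) (A : comAlgType K) (m : nat)
    (p : {poly K}) (y : K) (v s : A) :
  (size p <= m.+1)%N ->
  \sum_(i < m.+1) p`_i *: ((y *: v + s) ^+ i * v ^+ (m - i)) =
  \sum_(j < m.+1) p^`N(j).[y] *: (s ^+ j * v ^+ (m - j)).
Proof.
move=> sp; under [RHS]eq_bigr => j _ do
  rewrite (horner_nderivn_wide _ _ sp) scaler_suml.
rewrite exchange_big; apply: eq_bigr => -[i /= im] _.
under eq_bigr do rewrite -scalerA.
rewrite -scaler_sumr; congr (_ *: _).
rewrite exprDn mulr_suml.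
rewrite (big_ord_widen m.+1 (fun j => (y *: v) ^+ (i - j) * s ^+ j *+ 'C(i, j) *
  v ^+ (m - i))) // big_mkcond; apply: eq_bigr => -[j /= jm] _.
rewrite ltnS; case: leqP => [ji|ij]; last by rewrite bin_small // mulr0n scale0r.
rewrite exprZn -!scalerAl scalerMnl -scalerAl; congr (_ *: _).
by rewrite mulrAC -exprD mulrC; congr (_ * v ^+ _); lia.
Qed.

(** * Taylor expansion of the transformed polynomial *)

Section LocalExpansion.
Variable F : fieldType.
Implicit Types g : SL2 F.

Definition denom g : {poly F} := g 1 0 *: 'X + (g 1 1)%:P.

Lemma horner_denom g x : (denom g).[x] = g 1 0 * x + g 1 1.
Proof. by rewrite /denom !hornerE. Qed.

Lemma det_SL2E g : g 0 0 * g 1 1 - g 0 1 * g 1 0 = 1.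
Proof.
rewrite -(det_SL2 g) (expand_det_row _ 0) !big_ord_recl big_ord0 /cofactor.
rewrite !det_mx11 !mxE /= addr0 mul1r expr1 mulN1r mulrN.
by congr (g _ _ * g _ _ - g _ _ * g _ _); apply/val_inj.
Qed.

Lemma denom_neq0 g : denom g != 0.
Proof.
apply/eqP => g0; have := det_SL2E g.
have := congr1 (coefp 0) g0; have := congr1 (coefp 1) g0.
rewrite /coefp !coefD !coefZ !coefX !coefC /= mulr1 mulr0 addr0 add0r.
by move=> -> ->; rewrite !mulr0 subrr => /esym/eqP; rewrite oner_eq0.
Qed.

(** The entries of the matrix relating the Taylor coefficients of [p] at
    [y = (a x + b) / (c x + d)] to those of [g . p] at [x], where
    [u = c x + d]: with ['X] standing for the increment of [x], the denominator
    at the displaced point is [v = u + c 'X], and its numerator is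
    [y v + 'X / u]. *)
Definition taylor_entry (c u : F) (n : nat) (j s : nat) : F :=
  (((u^-1 *: 'X) ^+ j * (u%:P + c *: 'X) ^+ (n - j)) : {poly F})`_s.

Lemma taylor_entry_lt c u n j s : (s < j)%N -> taylor_entry c u n j s = 0.
Proof. by move=> sj; rewrite /taylor_entry exprZn -scalerAl coefZ coefXnM sj mulr0. Qed.

Lemma taylor_entry_diag c u n j : taylor_entry c u n j j = u ^- j * u ^+ (n - j).
Proof.
rewrite /taylor_entry exprZn -scalerAl coefZ coefXnM ltnn subnn exprVn; congr (_ * _).
by rewrite -horner_coef0 horner_exp !hornerE ?mulr0 ?addr0.
Qed.

(** The change of variable is local at [x]: the Taylor coefficients of [g . p]
    at [x] are linear combinations of those of [p] at the image point [y], the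
    [s]-th one involving only orders at most [s] by [taylor_entry_lt]. *)
Lemma nderivn_SL2_act n g (p : {poly_n.+1 F}) (x : F) s :
  let u := g 1 0 * x + g 1 1 in let y := (g 0 0 * x + g 0 1) / u in
  u != 0 ->
  (SL2_act g p : {poly F})^`N(s).[x] =
  \sum_(j < n.+1) (p : {poly F})^`N(j).[y] * taylor_entry (g 1 0) u n j s.
Proof.
move=> u y u0; set q : {poly F} := SL2_act g p.
(* The size is raised to [s.+1 + size q] so that the [s]-th coefficient lies
   within the range of the expansion, whatever [s]. *)
have -> : q^`N(s).[x] = (q \Po (x%:P + 'X))`_s.
  rewrite /comp_poly (@nderiv_taylor_wide _ (s.+1 + size q)) ?size_map_polyC;
    [|exact: mulrC|exact: leq_addl].
  under eq_bigr do rewrite nderivn_map horner_map /= mul_polyC.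
  by rewrite -(poly_def _ (fun i => q^`N(i).[x])) coef_poly ltn_addr.
have -> : q \Po (x%:P + 'X) = \sum_(j < n.+1) (p : {poly F})^`N(j).[y] *:
    ((u^-1 *: 'X) ^+ j * (u%:P + g 1 0 *: 'X) ^+ (n - j)).
  rewrite -(homogeneous_taylor y _ _ (size_npoly p)).
  rewrite /q /= /SL2_act_poly linear_sum; apply: eq_bigr => i _ /=.
  rewrite comp_polyZ comp_polyM !rmorphXn /= !comp_polyD !comp_polyZ !comp_polyC.
  rewrite !comp_polyX; congr (_ *: (_ ^+ i * _ ^+ _)).
    (* As [det g = 1], the derivative [(a - y c) / u] of the Moebius map at
       [x] is [u ^- 2]. *)
    have -> : u^-1 *: 'X = (g 0 0 - y * g 1 0) *: 'X :> {poly F}.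
      congr (_ *: _); rewrite -[LHS]mul1r -(det_SL2E g) /y.
      by apply: (mulIf u0); rewrite mulfVK // mulrBl [_ / u * _ * _]mulrAC mulfVK // /u; ring.
    rewrite -!mul_polyC !rmorphB !rmorphM /=.
    have -> : (g 0 1)%:P = (y * u - g 0 0 * x)%:P :> {poly F}.
      by rewrite /y mulfVK //; congr (_%:P); ring.
    by rewrite !(rmorphB, rmorphM) /=; ring.
  by rewrite -!mul_polyC /u !(rmorphD, rmorphM) /=; ring.
by rewrite coef_sum; apply: eq_bigr => j _; rewrite coefZ.
Qed.

Lemma prod_taylor_entry_diag (u : F) n k : u != 0 -> (k <= n.+1)%N ->
  \prod_(j < k) (u ^- j * u ^+ (n - j)) = u ^+ (k * (n.+1 - k)).
Proof.
move=> u0; elim: k => [|k IHk] kn; first by rewrite big_ord0.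
rewrite big_ord_recr /= IHk ?(ltnW kn) //.
rewrite mulrCA; apply: (mulfI (expf_neq0 k u0)); rewrite mulVKf ?expf_neq0 //.
by rewrite -!exprD; congr (_ ^+ _); nia.
Qed.

(** The factorials by which derivatives differ from Taylor coefficients come
    out as column factors, so that the two determinants are proportional by a
    constant that does not depend on the polynomials or on the point. *)
Lemma wronskian_polyE n k (p : k.-tuple {poly_n.+1 F}) x :
  (wronskian_poly p).[x] = (\prod_(j < k) (j`!)%:R) *
    \det (\matrix_(i < k, j < k) (tnth p i : {poly F})^`N(j).[x]).
Proof.
rewrite /wronskian_poly -horner_evalE -det_map_mx.
rewrite mulrC; set N := \matrix_(i, j) _.
have -> : \prod_(j < k) (j`!)%:R = \det (diag_mx (\row_(j < k) (j`!)%:R)) :> F.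
  by rewrite det_diag; apply: eq_bigr => j _; rewrite mxE.
rewrite -det_mulmx mul_mx_diag; congr (\det _); apply/matrixP => i j.
by rewrite !mxE /= horner_evalE nderivn_def hornerMn mulr_natr.
Qed.

End LocalExpansion.

(** * Covariance of the Wronskian and group action laws *)

(** In characteristic zero a nonzero polynomial has a non-root, namely some
    natural number. This lets the polynomial identities below be checked only
    at points where the denominators of the Moebius maps do not vanish. *)
Lemma poly_eq_off_roots (R : numDomainType) (v p q : {poly R}) : v != 0 ->
  (forall x, v.[x] != 0 -> p.[x] = q.[x]) -> p = q.
Proof.
move=> v0 pq; apply/eqP; rewrite -subr_eq0.
suff /eqP: (p - q) * v = 0 by rewrite mulf_eq0 (negPf v0) orbF.
apply: (@roots_geq_poly_eq0 _ _ [seq i%:R | i <- iota 0 (size ((p - q) * v))]).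
- apply/allP => x _; rewrite rootE hornerM !hornerE mulf_eq0.
  by have [_|/pq->] := eqVneq v.[x] 0; rewrite ?orbT // subrr eqxx.
- by rewrite map_inj_uniq ?iota_uniq // => i j /eqP; rewrite eqr_nat => /eqP.
- by rewrite size_map size_iota.
Qed.

Section Covariance.
Variable F : numFieldType.
Implicit Types g h : SL2 F.

(** By [nderivn_SL2_act] the two matrices of Taylor coefficients differ by a
    triangular factor; its determinant, computed by [prod_taylor_entry_diag], is
    precisely the factor of automorphy of weight [k * (n.+1 - k)]. *)
Lemma wronskian_SL2_act n k g (p : k.-tuple {poly_n.+1 F}) :
  (k <= n.+1)%N ->
  wronskian (map_tuple (SL2_act g) p) = SL2_act g (wronskian p).
Proof.
move=> kn; apply/val_inj; apply: (poly_eq_off_roots (denom_neq0 g)) => x.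
rewrite horner_denom => u0; rewrite horner_SL2_act //= !wronskian_polyE.
set u := g 1 0 * x + g 1 1 in u0 *; set y := _ / u.
rewrite mulrCA; congr (_ * _).
have -> : u ^+ (k * (n.+1 - k)) =
    \det (\matrix_(j < k, s < k) taylor_entry (g 1 0) u n j s).
  rewrite -prod_taylor_entry_diag // -det_tr det_trig.
    by apply: eq_bigr => j _; rewrite !mxE taylor_entry_diag.
  by apply/is_trig_mxP => i j ij; rewrite !mxE taylor_entry_lt.
rewrite mulrC -det_mulmx; congr (\det _); apply/matrixP => i s.
rewrite !mxE tnth_map nderivn_SL2_act // -/u -/y.
under [RHS]eq_bigr do rewrite !mxE.
(* Orders [j] with [k <= j] do not contribute, by triangularity, so the
   truncation to the first [k] Taylor coefficients is a matrix product. *)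
rewrite [RHS](big_ord_widen n.+1 (fun j =>
  (tnth p i : {poly F})^`N(j).[y] * taylor_entry (g 1 0) u n j s)) //.
rewrite [RHS]big_mkcond; apply: eq_bigr => j _ /=.
by case: ltnP => // kj; rewrite taylor_entry_lt ?mulr0 // (leq_trans _ kj).
Qed.

Section Action.
Variable m : nat.

Lemma SL2_act_mul g h (p : {poly_m.+1 F}) :
  SL2_act g (SL2_act h p) = SL2_act (h * g)%g p.
Proof.
apply/val_inj; apply: (poly_eq_off_roots (mulf_neq0 (denom_neq0 g)
  (denom_neq0 (h * g)%g))) => x.
rewrite hornerM mulf_eq0 negb_or !horner_denom => /andP[].
set u := _ + _ => u0 w0.
(* For [i = 0] and [i = 1]: numerator and denominator of [h] at the image of
   [x] under [g]. *)
have numE (i : 'I_2) : h i 0 * ((g 0 0 * x + g 0 1) / u) + h i 1 =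
    ((h * g)%g i 0 * x + (h * g)%g i 1) / u.
  apply: (mulIf u0); rewrite mulrDl mulrA !mulfVK //= !mxE !big_ord_recl.
  rewrite !big_ord0 !addr0 /u (_ : lift ord0 ord0 = 1 :> 'I_2); last exact/val_inj.
  by ring.
rewrite !horner_SL2_act -/u //; last by rewrite numE mulf_neq0 ?invr_neq0.
rewrite !numE invf_div [in _ / u * _]mulrA mulfVK // mulrA -exprMn.
by rewrite [u * _]mulrC mulfVK.
Qed.

Lemma SL2_act1 (p : {poly_m.+1 F}) : SL2_act 1%g p = p.
Proof.
apply/val_inj; apply: (poly_eq_off_roots (denom_neq0 1%g)) => x.
rewrite horner_denom => u0; rewrite horner_SL2_act // !mxE /=.
by rewrite mul1r mul0r addr0 add0r expr1n mul1r divr1.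
Qed.

Implicit Types U : {vspace {poly_m.+1 F}}.

Lemma SL2_act_vs_mul g h U :
  SL2_act_vs g (SL2_act_vs h U) = SL2_act_vs (h * g)%g U.
Proof.
rewrite /SL2_act_vs -limg_comp; congr (_ @: _)%VS.
by apply/lfunP => p; rewrite comp_lfunE !lfunE /= SL2_act_mul.
Qed.

Lemma SL2_act_vs1 U : SL2_act_vs 1%g U = U.
Proof.
rewrite /SL2_act_vs -[RHS]lim1g; congr (_ @: _)%VS.
by apply/lfunP => p; rewrite id_lfunE lfunE /= SL2_act1.
Qed.

Lemma SL2_act_inj g : injective (@SL2_act F m g).
Proof.
apply: (can_inj (g := SL2_act g^-1%g)) => p.
by rewrite SL2_act_mul mulgV SL2_act1.
Qed.

End Action.

(** The group acts by linear automorphisms, so it carries a basis of [U] to a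
    basis of its image, and both lines can be computed in these bases. *)
Lemma wronskian_line_act n (k : nat) g (U : {vspace {poly_n.+1 F}}) :
  \dim U = k ->
  wronskian_line k (SL2_act_vs g U) = SL2_act_vs g (wronskian_line k U).
Proof.
move=> <-; have bU := vbasisP U.
have kn : (\dim U <= n.+1)%N.
  by rewrite (leq_trans (dimvS (subvf U))) // dimvf /dim /=.
have bgU : basis_of (SL2_act_vs g U) (map_tuple (SL2_act g) (vbasis U)).
  have -> : map_tuple (SL2_act g) (vbasis U) =
      [seq linfun (SL2_act g) r | r <- vbasis U] :> seq _.
    by apply: eq_map => r; rewrite lfunE.
  apply: limg_basis_of => //.
  suff /eqP-> : lker (linfun (@SL2_act F n g)) == 0%VS by rewrite capv0.
  by apply/lker0P => r s; rewrite !lfunE => /SL2_act_inj.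
rewrite (wronskian_lineE bgU) (wronskian_lineE bU) wronskian_SL2_act //.
by rewrite /SL2_act_vs limg_line lfunE.
Qed.

End Covariance.

(** * Rigidity *)

(** Since the action is on the right, it is [h * g^-1], and not [g^-1 * h],
    that stabilizes [W]. *)
Lemma eq_pm_of_trivial_Stab (F : numFieldType) m (W : {vspace {poly_m.+1 F}})
    (g h : SL2 F) :
  Stab W =i pred1 (1%g : PSL2 F) -> SL2_act_vs h W = SL2_act_vs g W ->
  eq_pm h g.
Proof.
move=> stab hg.
have : (\pi_(PSL2 F) (h * g^-1)%g)%qT \in Stab W.
  by rewrite inE PSL2_act_vs_pi -SL2_act_vs_mul hg SL2_act_vs_mul mulgV SL2_act_vs1.
rewrite stab inE => /eqP/eqmodP/orP[]/eqP /= hg1.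
all: rewrite /eq_pm -[h : 'M_2](mulmxKV (SL2_unit g)) hg1.
  by rewrite mul1mx eqxx.
by rewrite mulNmx mul1mx eqxx orbT.
Qed.

Local Open Scope complex_scope.

Theorem proposition1p2 (R : realType) (n k : nat)
    (U Uhat : {vspace {poly_n.+1 R[i]}}) (g : SL2 R[i]) :
  (1 <= k <= n.+1)%N ->
  \dim U = k ->
  \dim Uhat = k ->
  wronskian_line k Uhat = SL2_act_vs g (wronskian_line k U) ->
  Stab (wronskian_line k U) =i pred1 (1%g : PSL2 R[i]) ->
  (proj_equiv U Uhat <-> Uhat = SL2_act_vs g U).
Proof.
move=> _ dimU _ WgW stab; split=> [[h hU]|->]; last by exists g.
rewrite hU; apply/SL2_act_vs_pm/(eq_pm_of_trivial_Stab stab).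
by rewrite -wronskian_line_act // -hU.
Qed.
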